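(* Assume the seeds are i.i.d. uniform on $[n]$. Let $M:\mathbb N\to\mathbb N$ satisfy $\lim_{n\to\infty}M(n)/\log n=\infty$. Let $(l_n)$, indexed by even $n\ge6$, be a sequence of integers such that eventually $l_n\in L_{opt}(n,M(n))$, where $$L_{opt}(n,m)=\operatorname*{arg\,max}_{l\in\{2,\dots,n/2-1\}}p_1(n,m,l).$$ Then, as $n\to\infty$ along even integers, $$\lim_{n\to\infty}\frac{l_n}{n}=\frac15\qquad\text{and}\qquad \limsup_{n\to\infty}\frac{1}{M(n)}\log\bigl[1-p_1(n,M(n),l_n)\bigr]\le\log\frac45 .$$
   Context: Candidates $[n]$, $m$ voters; voter $j$ has the clockwise oriented preference list $(s_j,s_j+1,\dots,n,1,\dots,s_j-1)$ with seed $s_j$; seeds are independent and uniform on $[n]$. In an election among a non-empty $S\subseteq[n]$ each voter votes for the first candidate of $S$ in its list; $\Xi_S(i)$ is the number of votes for $i$. Two-round election with partition $(A,B)$: the winner of $A$ is the $a\in A$ with $\Xi_A(a)>\Xi_A(a')$ for all other $a'\in A$ (if none, nobody wins); likewise for $B$; between first-round winners $a,b$, $a$ wins iff $\Xi_{\{a,b\}}(a)>\Xi_{\{a,b\}}(b)$ (ties: nobody wins). For even $n$ and $2\le l<n/2$, $A^{(1,n,l)}=\{1,\dots,l\}\cup\{l+2i:1\le i\le(n-2l)/2\}$, $B^{(1,n,l)}=[n]\setminus A^{(1,n,l)}$, and $p_1(n,m,l)$ is the probability that candidate $1$ wins the two-round election with partition $(A^{(1,n,l)},B^{(1,n,l)})$;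 $\log 0=-\infty$. *)

(* Defs.v *)
From Stdlib Require Import Reals.
From mathcomp Require Import all_boot.

(* Candidates are the naturals 1..n; a seed s in 1..n.  The voter with seed s
   ranks candidates s, s+1, ..., n, 1, ..., s-1, i.e. by increasing cdist n s c. *)
Definition cdist (n s c : nat) : nat := (c + n - s) %% n.

Definition in_range (n c : nat) : bool := (1 <= c) && (c <= n).

Definition first_choice (n : nat) (S : pred nat) (s c : nat) : bool :=
  [&& in_range n c, S c &
      all (fun c' => S c' ==> ((c' == c) || (cdist n s c < cdist n s c')))
          (iota 1 n)].

(* Xi_S(c): number of votes for c in the election among S.  Seeds are given as
   seeds : {ffun 'I_m -> 'I_n}; voter j has seed (seeds j) + 1 in 1..n. *)
Definition Xi (n m : nat) (S : pred nat) (seeds : {ffun 'I_m -> 'I_n}) (c : nat) : nat :=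
  #|[pred j : 'I_m | first_choice n S (nat_of_ord (seeds j)).+1 c]|.

Definition round_winner (n m : nat) (S : pred nat) (seeds : {ffun 'I_m -> 'I_n}) (a : nat) : bool :=
  [&& in_range n a, S a &
      all (fun a' => S a' ==> ((a' == a) || (Xi n m S seeds a' < Xi n m S seeds a)))
          (iota 1 n)].

Definition A1 (n l : nat) : pred nat :=
  fun c => in_range n c &&
    ((c <= l) || has (fun i => c == l + 2 * i) (iota 1 ((n - 2 * l) %/ 2))).

Definition B1 (n l : nat) : pred nat := fun c => in_range n c && ~~ A1 n l c.

Definition pair_pred (a b : nat) : pred nat := fun c => (c == a) || (c == b).

Definition one_wins (n m l : nat) (seeds : {ffun 'I_m -> 'I_n}) : bool :=
  round_winner n m (A1 n l) seeds 1 &&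
  has (fun b => round_winner n m (B1 n l) seeds b &&
                (Xi n m (pair_pred 1 b) seeds b < Xi n m (pair_pred 1 b) seeds 1))
      (iota 1 n).

(* p_1(n,m,l): seeds i.i.d. uniform on [n], i.e. uniform on the n^m seed vectors *)
Definition p1 (n m l : nat) : R :=
  Rdiv (INR #|[pred s : {ffun 'I_m -> 'I_n} | one_wins n m l s]|) (INR (n ^ m)).

Definition in_Lopt (n m l : nat) : Prop :=
  (2 <= l) && (l <= n %/ 2 - 1) /\
  forall l' : nat, (2 <= l') && (l' <= n %/ 2 - 1) -> Rle (p1 n m l') (p1 n m l).

(* Main.v *)
Require Import Defs.
From Stdlib Require Import Reals Lra Psatz.
From mathcomp Require Import all_boot zify.

(** Let [x = l/n].  In the election among [A] candidate 1 collects about [n x] of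
    the [n] seeds and every other candidate at most 2; among [B] the same holds
    with [l+1] in place of 1; in the duel, [l+1] gets the votes of exactly [l]
    seeds.  By exponential tilting and a union bound over the candidates,
    candidate 1 fails with probability at most [exp(o(m))] times the [m]-th power
    of [max (1 - x) (2 sqrt (x (1 - x)))].  Conversely it fails if it receives no
    vote in [A], of probability [(1 - x - 1/n)^m], and if a strict majority of the
    seeds falls in [2..l+1]: then [l+1] wins [B] and the duel.  The maximum is
    smallest at [x = 1/5], with value [4/5], so it suffices to compare an
    optimal [l] with [n %/ 5]. *)

(** * Ballots and the partition *)

Lemma cdistE n s c : 0 < s <= n -> 0 < c <= n ->
  cdist n s c = if s <= c then c - s else c + n - s.
Proof.
move=> hs hc; rewrite /cdist; case: leqP => hsc.
  by rewrite (_ : c + n - s = c - s + n) ?modnDr ?modn_small; lia.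
by rewrite modn_small; lia.
Qed.

Lemma first_choiceP n (S : pred nat) s c : 0 < s <= n ->
  reflect [/\ 0 < c <= n, S c & forall c', 0 < c' <= n -> S c' -> c' != c ->
              cdist n s c < cdist n s c'] (first_choice n S s c).
Proof.
move=> hs; apply: (iffP and3P) => -[hc Sc h]; split=> //.
  move=> c' hc' Sc' /negPf ne; move/allP: h => /(_ c').
  by rewrite mem_iota Sc' ne /=; apply; lia.
apply/allP=> c'; rewrite mem_iota => hc'; apply/implyP => Sc'.
by case: eqVneq => //= ne; apply: h => //; lia.
Qed.

Lemma first_choice_inj n (S : pred nat) s c c' : 0 < s <= n ->
  first_choice n S s c -> first_choice n S s c' -> c = c'.
Proof.
move=> hs /first_choiceP-/(_ hs)[hc Sc h] /first_choiceP-/(_ hs)[hc' Sc' h'].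
apply/eqP; apply: contraT => ne.
by have := h _ hc' Sc'; have := h' _ hc Sc ne; rewrite eq_sym ne => ? /(_ isT); lia.
Qed.

(** A seed at or before [p], or after [a], reaches [p] before [a] on its clockwise walk. Vote counts
    thus reduce to gaps between consecutive members of [S]. *)
Lemma first_choice_gap n (S : pred nat) s p a : 0 < s <= n -> 0 < p < a -> S p ->
  first_choice n S s a -> p < s <= a.
Proof.
move=> hs hp Sp /first_choiceP-/(_ hs)[ha Sa /(_ p)].
by rewrite Sp !cdistE; try lia; case: (leqP s a); case: (leqP s p); lia.
Qed.

Lemma A1E n l c : ~~ odd n -> l.*2 < n ->
  Defs.A1 n l c = (0 < c <= l) || (l < c <= n - l) && ~~ odd (c - l).
Proof.
move=> en hl; rewrite /Defs.A1 /in_range.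
have -> : has (fun i => c == l + 2 * i) (iota 1 ((n - 2 * l) %/ 2)) =
   (l < c <= n - l) && ~~ odd (c - l).
  apply/hasP/idP => [[i]|h]; first by rewrite mem_iota => hi /eqP ->; lia.
  by exists ((c - l) %/ 2); rewrite ?mem_iota; lia.
lia.
Qed.

Lemma B1E n l c : ~~ odd n -> l.*2 < n ->
  Defs.B1 n l c = (l < c <= n - l) && odd (c - l) || (n - l < c <= n).
Proof. by move=> en hl; rewrite /Defs.B1 A1E // /in_range; lia. Qed.

Lemma card_ord_itv n a b : b <= n -> #|[pred s : 'I_n | a <= s < b]| = b - a.
Proof.
move=> bn; rewrite -sum1_card big_mkcond /=.
suff -> k : \sum_(s < k) (if a <= s < b then 1 else 0) = minn b k - a by lia.
elim: k => [|k IH]; first by rewrite big_ord0; lia.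
by rewrite big_ord_recr /= IH; case: ifP; lia.
Qed.

Lemma card_le_itv n (P : pred 'I_n) a b :
  b <= n -> (forall s : 'I_n, P s -> a <= s < b) -> #|P| <= b - a.
Proof.
move=> bn h; rewrite -(card_ord_itv n a b bn).
by apply: subset_leq_card; apply/subsetP => s; rewrite !inE; apply: h.
Qed.

Lemma itv_le_card n (P : pred 'I_n) a b :
  b <= n -> (forall s : 'I_n, a <= s < b -> P s) -> b - a <= #|P|.
Proof.
move=> bn h; rewrite -(card_ord_itv n a b bn).
by apply: subset_leq_card; apply/subsetP => s; rewrite !inE; apply: h.
Qed.

(** The ordinal [s] stands for the seed [s.+1], so the seed intervals below appear shifted down by
    one. *)
Definition votes_for n (S : pred nat) c : pred 'I_n :=
  fun s => first_choice n S s.+1 c.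

Lemma in_votes_for n S c s : (s \in votes_for n S c) = votes_for n S c s.
Proof. by []. Qed.

Lemma votes_for_disjoint n S c c' s :
  c != c' -> votes_for n S c s -> ~~ votes_for n S c' s.
Proof.
move=> ne h; apply: contra ne => h'; apply/eqP.
by apply: first_choice_inj h h'; have := ltn_ord s; lia.
Qed.

Lemma seed_range n (s : 'I_n) : 0 < s.+1 <= n.
Proof. exact: ltn_ord s. Qed.

Lemma card_votes_le n (S : pred nat) a k :
  (0 < a <= n -> S a -> exists2 p, 0 < p < a & S p && (a <= p + k)) ->
  #|votes_for n S a| <= k.
Proof.
move=> gap; have [/andP[an Sa]|nS] := boolP ((0 < a <= n) && S a); last first.
  rewrite eq_card0 // => s; apply/negP => /first_choiceP-/(_ (seed_range n s))[an Sa _].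
  by rewrite an Sa in nS.
have [p hp /andP[Sp ak]] := gap an Sa; apply: (@leq_trans (a - p)); last lia.
apply: card_le_itv => [|s h]; first lia.
exact: (first_choice_gap _ _ _ p _ (seed_range n s) hp Sp h).
Qed.

(** * Vote counts per candidate for the given partition *)

Section Partition.
Variables (n l : nat).
Hypotheses (en : ~~ odd n) (l2 : 2 <= l) (lhalf : l.*2 < n).
Local Notation A := (Defs.A1 n l).
Local Notation B := (Defs.B1 n l).
Local Notation pair := (pair_pred 1 l.+1).

(** The largest member of [A] is [n - l], so the seeds beyond it wrap around to candidate 1. *)
Lemma votes_A_1 s : votes_for n A 1 s = (s < 1) || (n - l <= s).
Proof.
have hs := seed_range n s; apply/first_choiceP/idP => // [[_ _ h]|h].
  have := h (n - l); rewrite A1E // !cdistE //; repeat case: ifP; lia.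
split; rewrite ?A1E //; try lia.
by move=> c hc; rewrite A1E // !cdistE //; repeat case: ifP; lia.
Qed.

Lemma card_votes_A_1 : #|votes_for n A 1| = l.+1.
Proof.
have := cardC (votes_for n A 1); rewrite card_ord.
have -> : #|[predC votes_for n A 1]| = n - l - 1.
  rewrite -(card_ord_itv n 1 (n - l)); last lia.
  by apply: eq_card => s; rewrite !inE in_votes_for votes_A_1 //; lia.
by move: #|_| => k; lia.
Qed.

(** Every other member of [A] has a member of [A] shortly before it: one place before inside the
    block [1..l], two places before in the alternating stretch. *)
Lemma card_votes_A a : a != 1 -> #|votes_for n A a| <= 2.
Proof.
move=> a1; apply: card_votes_le => an; rewrite A1E // => /orP[] h.
  by exists a.-1; rewrite ?A1E; lia.
by exists (a - 2); rewrite ?A1E; lia.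
Qed.

Lemma votes_B_l1 (s : 'I_n) : s <= l -> votes_for n B l.+1 s.
Proof.
move=> sl; have hs := seed_range n s; apply/first_choiceP => //.
split; rewrite ?B1E //; try lia.
by move=> c hc; rewrite B1E // !cdistE //; repeat case: ifP; lia.
Qed.

Lemma card_votes_B_l1 : l.+1 <= #|votes_for n B l.+1|.
Proof.
rewrite -{1}[l.+1]subn0; apply: itv_le_card; first lia.
by move=> s h; apply: votes_B_l1.
Qed.

(** [B] starts at [l.+1], takes every second candidate up to [n - l] and all candidates after that,
    so only [l.+1] lacks a predecessor at distance 1 or 2. *)
Lemma card_votes_B b : b != l.+1 -> #|votes_for n B b| <= 2.
Proof.
move=> b1; apply: card_votes_le => bn; rewrite B1E // => Bb.
by case: (boolP (B b.-1)) => Bp; [exists b.-1 | exists (b - 2)]; move: Bp; rewrite ?B1E; lia.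
Qed.

Lemma votes_pair_1 s : votes_for n pair 1 s = (s < 1) || (l < s).
Proof.
have hs := seed_range n s; apply/first_choiceP/idP => // [[_ _ h]|h].
  have := h l.+1; rewrite /pair_pred !cdistE //; repeat case: ifP; lia.
split; rewrite /pair_pred //; try lia.
by move=> c hc; rewrite !cdistE //; repeat case: ifP; lia.
Qed.

Lemma votes_pair_l1 s : votes_for n pair l.+1 s = (0 < s <= l).
Proof.
have hs := seed_range n s; apply/first_choiceP/idP => // [[_ _ h]|h].
  have := h 1; rewrite /pair_pred !cdistE //; repeat case: ifP; lia.
split; rewrite /pair_pred //; try lia.
by move=> c hc; rewrite !cdistE //; repeat case: ifP; lia.
Qed.

Lemma card_votes_pair_l1 : #|votes_for n pair l.+1| = l.
Proof.
rewrite -[RHS]subn0 -[in RHS](subSS 0 l) -(card_ord_itv n 1 l.+1); last lia.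
by apply: eq_card => s; rewrite !inE in_votes_for votes_pair_l1.
Qed.

Lemma card_votes_pair_1 : #|votes_for n pair 1| = n - l.
Proof.
have := cardC (votes_for n pair l.+1); rewrite card_ord card_votes_pair_l1 => e.
rewrite -[X in _ = X - l]e addKn; apply: eq_card => s.
by rewrite !inE !in_votes_for votes_pair_1 votes_pair_l1; lia.
Qed.

End Partition.

(** * Counting seed vectors *)

Section Chernoff.
Variables (T : finType) (m : nat).
Implicit Types (P Q : pred T) (f : {ffun 'I_m -> T}).

(* The weights [K, 1/K, 1] of exponential tilting, scaled by [K] to be integers. *)
Definition tilt K P Q s := if P s then K ^ 2 else if Q s then 1 else K.

Lemma prod_expn_count (K : nat) P f :
  \prod_(j < m) K ^ (P (f j)) = K ^ #|[pred j | P (f j)]|.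
Proof.
rewrite -expn_sum; congr (_ ^ _); rewrite -sum1_card [RHS]big_mkcond /=.
by apply: eq_bigr => j _; rewrite inE; case: (P _).
Qed.

(** Markov's inequality for the product of the weights: it is at least [K ^ m] on every vector with
    at least as many entries in [P] as in [Q], and its sum over all vectors factorizes. *)
Lemma chernoff_count K P Q : 0 < K -> (forall s, P s -> ~~ Q s) ->
  K ^ m * #|[pred f : {ffun 'I_m -> T} | #|[pred j | Q (f j)]| <= #|[pred j | P (f j)]|]|
    <= (\sum_s tilt K P Q s) ^ m.
Proof.
move=> K0 PQ.
have -> : (\sum_s tilt K P Q s) ^ m = \sum_(f : {ffun 'I_m -> T}) \prod_(j < m) tilt K P Q (f j).
  by rewrite -(bigA_distr_bigA (fun (_ : 'I_m) s => tilt K P Q s)) prod_nat_const card_ord.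
rewrite mulnC -sum_nat_const big_mkcond leq_sum //= => f _.
(* Multiplying by [K] to the number of entries in [Q] avoids negative exponents. *)
rewrite inE; case: ifP => // qp; rewrite -(@leq_pmul2r (K ^ #|[pred j | Q (f j)]|)) ?expn_gt0 ?K0 //.
rewrite -{2}prod_expn_count -big_split /=.
have -> : \prod_(j < m) (tilt K P Q (f j) * K ^ Q (f j)) = K ^ m * K ^ #|[pred j | P (f j)]|.
  rewrite -prod_expn_count -[in K ^ m](card_ord m) -prod_nat_const -big_split /=.
  apply: eq_bigr => j _; rewrite /tilt; case: ifP => [/PQ/negPf ->|_].
    by rewrite expn0 expn1 muln1 mulnn.
  by case: ifP => _; rewrite ?expn0 ?expn1 ?muln1 ?mul1n.
by rewrite leq_mul2l (leq_pexp2l K0 qp) orbT.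
Qed.

(** Pointwise, the weight is [K], plus [K * K.-1] on [P], minus [K.-1] on [Q]. The negative term is
    moved to the left to avoid truncated subtraction. *)
Lemma sum_tilt_le K P Q u v : 0 < K -> (forall s, P s -> ~~ Q s) ->
  #|P| <= u -> v <= #|Q| ->
  \sum_s tilt K P Q s + K.-1 * v <= K * #|T| + K * K.-1 * u.
Proof.
move=> K0 PQ Pu vQ.
apply: (@leq_trans (K * #|T| + K * K.-1 * #|P|)); last by rewrite leq_add2l leq_mul2l Pu orbT.
apply: (@leq_trans (\sum_s tilt K P Q s + K.-1 * #|Q|)); first by rewrite leq_add2l leq_mul2l vQ orbT.
have cardE R : #|R| = \sum_(s : T) (R s : nat).
  by rewrite -sum1_card big_mkcond; apply: eq_bigr => s _; rewrite unfold_in; case: (R s).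
rewrite (cardE P) (cardE Q) -sum1_card !big_distrr -!big_split /=.
apply: leq_sum => s _; rewrite /tilt; case: ifP => [/PQ/negPf ->|_]; last by case: ifP; lia.
by case: K K0 => // K _; lia.
Qed.

(** Vectors are sorted by the set [J] of indices whose entry lies in [P]; for fixed [J] the entries
    are chosen independently. *)
Lemma card_exact_count P k :
  #|[pred f : {ffun 'I_m -> T} | #|[pred j | P (f j)]| == k]|
    = 'C(m, k) * (#|P| ^ k * (#|T| - #|P|) ^ (m - k)).
Proof.
rewrite -[m in 'C(m, k)]card_ord -card_draws -sum_nat_const /=.
rewrite -[LHS]sum1_card (partition_big (fun f => [set j | P (f j)])
  (fun J => J \in [set J : {set 'I_m} | #|J| == k])) /=; last first.
  by move=> f; rewrite !inE cardsE.
apply: eq_bigr => J; rewrite inE => /eqP Jk.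
rewrite sum1dep_card.
have -> : #|[set x : {ffun 'I_m -> T} | (#|[pred j | P (x j)]| == k) && ([set j | P (x j)] == J)]|
   = #|family (fun j => [pred s | P s == (j \in J)])|.
  rewrite cardsE; apply: eq_card => f; rewrite inE.
  apply/andP/familyP => [[_ /eqP <-] j|h]; first by rewrite !inE.
  have e : [set j | P (f j)] = J by apply/setP => j; rewrite inE; have := h j; rewrite inE => /eqP.
  by rewrite e -Jk -e cardsE !eqxx.
rewrite card_family foldrE big_map big_enum /=.
have e j : #|[pred s | P s == (j \in J)]| = if j \in J then #|P| else #|T| - #|P|.
  case: (j \in J); first by apply: eq_card => s; rewrite !inE eqb_id.
  by rewrite -(cardC P) addKn; apply: eq_card => s; rewrite !inE eqbF_neg.
rewrite (eq_bigr _ (fun j _ => e j)) (bigID (mem J)) /=.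
rewrite (eq_bigr (fun=> #|P|)) => [|j ->] //.
rewrite [X in _ * X](eq_bigr (fun=> #|T| - #|P|)) => [|j /negPf ->] //.
rewrite !prod_nat_const Jk; congr (_ * _ ^ _).
have e' := cardC (mem J); rewrite card_ord in e'.
by rewrite -[X in _ = X - k]e' Jk addKn; apply: eq_card => j; rewrite !inE.
Qed.

End Chernoff.

(** * Bounds on the number of seed vectors on which candidate 1 fails *)

Definition failures n m l :=
  #|[pred f : {ffun 'I_m -> 'I_n} | ~~ one_wins n m l f]|.

Lemma Xi_add_le n m (S : pred nat) (f : {ffun 'I_m -> 'I_n}) c c' :
  c != c' -> Xi n m S f c + Xi n m S f c' <= m.
Proof.
move=> ne; have <- := cardUI [pred j | votes_for n S c (f j)] [pred j | votes_for n S c' (f j)].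
rewrite [X in _ + X]eq_card0 ?addn0 => [|j].
  by rewrite -[X in _ <= X](card_ord m) max_card.
rewrite !inE; apply/negbTE; rewrite negb_and -implybE; apply/implyP.
exact: votes_for_disjoint.
Qed.

Lemma round_winnerP n m (S : pred nat) (f : {ffun 'I_m -> 'I_n}) a :
  reflect [/\ in_range n a, S a & forall c, in_range n c -> S c -> c != a ->
              Xi n m S f c < Xi n m S f a] (round_winner n m S f a).
Proof.
apply: (iffP and3P) => -[ha Sa h]; split=> //.
  move=> c hc Sc /negPf ne; move/allP: h => /(_ c).
  by rewrite mem_iota Sc ne /=; apply; move: hc; rewrite /in_range; lia.
apply/allP=> c; rewrite mem_iota => hc; apply/implyP => Sc.
by case: eqVneq => //= ne; apply: h => //; rewrite /in_range; lia.
Qed.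

Section Failures.
Variables (n m l : nat).
Hypotheses (en : ~~ odd n) (l2 : 2 <= l) (lhalf : l.*2 < n).
Local Notation A := (Defs.A1 n l).
Local Notation B := (Defs.B1 n l).
Local Notation pair := (pair_pred 1 l.+1).

Lemma failures_ge_novote : (n - l.+1) ^ m <= failures n m l.
Proof.
have -> : n - l.+1 = #|[predC votes_for n A 1]|.
  have e := cardC (votes_for n A 1); rewrite card_ord card_votes_A_1 // in e.
  by rewrite -[X in X - _]e addKn.
rewrite -[X in _ ^ X](card_ord m) -card_ffun_on.
apply: subset_leq_card; apply/subsetP => f /ffun_onP fA; rewrite !inE.
(* Candidate 2 lies in [A] because [2 <= l], and zero votes cannot strictly beat it. *)
apply/negP => /andP[/round_winnerP[_ _ /(_ 2)]] + _.
have -> : Xi n m A f 1 = 0 by apply: eq_card0 => j; apply/negbTE; exact: fA.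
by rewrite ltn0 A1E // /in_range => h; suff: false by []; apply: h; lia.
Qed.

(** The single binomial term for the least strict majority suffices. The duel voters of [l.+1] also
    vote for it in [B], so nobody else can win [B], and [l.+1] is not beaten in the duel. *)
Lemma failures_ge_majority :
  'C(m, m./2.+1) * (l ^ m./2.+1 * (n - l) ^ (m - m./2.+1)) <= failures n m l.
Proof.
rewrite -[X in X ^ _](card_votes_pair_l1 n l) // -[X in X - l](card_ord n).
rewrite -[X in _ - X](card_votes_pair_l1 n l) // -card_exact_count.
apply: subset_leq_card; apply/subsetP => f; rewrite !inE => /eqP fk.
apply/negP => /andP[_ /hasP[b _ /andP[/round_winnerP[hb Bb bW]]]].
have Xp : Xi n m pair f l.+1 = m./2.+1 by [].
have XB : m./2.+1 <= Xi n m B f l.+1.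
  rewrite -Xp; apply: subset_leq_card; apply/subsetP => j; rewrite !inE.
  rewrite -/(votes_for n pair l.+1 (f j)) -/(votes_for n B l.+1 (f j)).
  by rewrite votes_pair_l1 // => h; apply: votes_B_l1 => //; lia.
have [->|ne] := eqVneq b l.+1.
  have := Xi_add_le n m pair f 1 l.+1; rewrite Xp; lia.
have := bW l.+1; rewrite eq_sym ne B1E // /in_range => h _.
have := Xi_add_le n m B f b l.+1 ne; lia.
Qed.

Lemma chernoff_votes K S c0 c v u : 0 < K -> c != c0 ->
  #|votes_for n S c| <= u -> v <= #|votes_for n S c0| ->
  #|[pred f : {ffun 'I_m -> 'I_n} | Xi n m S f c0 <= Xi n m S f c]|
    <= (K * n + K * K.-1 * u - K.-1 * v) ^ m %/ K ^ m.
Proof.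
move=> K0 ne cu c0v; rewrite leq_divRL ?expn_gt0 ?K0 // mulnC.
have disj s : votes_for n S c s -> ~~ votes_for n S c0 s by exact: votes_for_disjoint.
apply: leq_trans (chernoff_count _ m K _ _ K0 disj) _.
have [->|m0] := posnP m; rewrite ?expn0 // leq_exp2r //.
have := sum_tilt_le _ K _ _ u v K0 disj cu c0v; rewrite card_ord; lia.
Qed.

Lemma failures_le K : 0 < K ->
  failures n m l <= 2 * n * ((K * n + K * K.-1 * 2 - K.-1 * l.+1) ^ m %/ K ^ m)
                    + (n + 3 * l) ^ m %/ 2 ^ m.
Proof.
move=> K0; set W := _ %/ K ^ m; set V := _ %/ 2 ^ m.
pose loseA a (f : {ffun 'I_m -> 'I_n}) := (a != 1) && (Xi n m A f 1 <= Xi n m A f a).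
pose loseB b (f : {ffun 'I_m -> 'I_n}) := (b != l.+1) && (Xi n m B f l.+1 <= Xi n m B f b).
pose losep (f : {ffun 'I_m -> 'I_n}) := Xi n m pair f 1 <= Xi n m pair f l.+1.
have cardE (Q : pred {ffun 'I_m -> 'I_n}) : #|[pred f | Q f]| = \sum_f (Q f : nat).
  by rewrite -sum1_card big_mkcond; apply: eq_bigr => f _; rewrite inE; case: (Q f).
have loseA_le a : #|[pred f | loseA a f]| <= W.
  have [->|ne] := eqVneq a 1; first by rewrite eq_card0.
  apply: leq_trans (chernoff_votes K A 1 a l.+1 2 K0 ne _ _); rewrite ?card_votes_A_1 ?card_votes_A //.
  by apply: subset_leq_card; apply/subsetP => f; rewrite !inE => /andP[].
have loseB_le b : #|[pred f | loseB b f]| <= W.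
  have [->|ne] := eqVneq b l.+1; first by rewrite eq_card0 // => f; rewrite !inE /loseB eqxx.
  apply: leq_trans (chernoff_votes K B l.+1 b l.+1 2 K0 ne _ _); rewrite ?card_votes_B_l1 ?card_votes_B //.
  by apply: subset_leq_card; apply/subsetP => f; rewrite !inE => /andP[].
have losep_le : #|[pred f | losep f]| <= V.
  (* The optimal tilt for the duel is [sqrt ((1 - x) / x)], which is 2 at [x = 1/5]. It makes the
     base [2n + 2l - (n - l) = n + 3l]. *)
  apply: leq_trans (chernoff_votes 2 pair 1 l.+1 (n - l) l isT _ _ _) _;
    rewrite ?card_votes_pair_l1 ?card_votes_pair_1 //; try lia.
  by rewrite /V (_ : _ - _ = n + 3 * l); lia.
have union (f : {ffun 'I_m -> 'I_n}) : ~~ one_wins n m l f <=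
    \sum_(a < n) loseA a.+1 f + \sum_(b < n) loseB b.+1 f + losep f.
  case: (boolP (one_wins n m l f)) => //= nwin; rewrite lt0n; apply: contra nwin.
  rewrite !addn_eq0 !sum_nat_eq0 => /andP[/andP[/forallP hA /forallP hB]].
  rewrite eqb0 /losep -ltnNge => hp.
  have ord_in c : in_range n c -> exists2 i : 'I_n, c = i.+1 & true.
    move=> hc; have lt : c.-1 < n by move: hc; rewrite /in_range; lia.
    by exists (Ordinal lt); move: hc; rewrite /in_range /=; lia.
  apply/andP; split.
    apply/round_winnerP; split; rewrite ?A1E // /in_range; try lia.
    move=> c /ord_in[i -> _] _ ne; have := hA i.
    by rewrite /= /loseA ne eqb0 -ltnNge.
  apply/hasP; exists l.+1; first by rewrite mem_iota; lia.
  rewrite hp andbT; apply/round_winnerP; split; rewrite ?B1E // /in_range; try lia.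
  move=> c /ord_in[i -> _] _ ne; have := hB i.
  by rewrite /= /loseB ne eqb0 -ltnNge.
rewrite /failures cardE; apply: leq_trans (leq_sum _ (fun f _ => union f)) _.
rewrite !big_split /= -cardE leq_add // mul2n -addnn mulnDl leq_add //.
  rewrite exchange_big /= -[X in _ <= X * _]card_ord -sum_nat_const.
  by apply: leq_sum => a _; rewrite -cardE.
rewrite exchange_big /= -[X in _ <= X * _]card_ord -sum_nat_const.
by apply: leq_sum => a _; rewrite -cardE.
Qed.

End Failures.

(** * Asymptotics *)

Lemma central_bin_ge r : 4 ^ r <= r.*2.+1 * 'C(r.*2, r).
Proof.
elim: r => // r IH.
have e1 := mul_bin_diag r.*2.+1 r.
have e2 := mul_bin_diag r.*2.+2 r.
have e3 : 'C(r.*2.+1, r) = 'C(r.*2.+1, r.+1).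
  by rewrite -[RHS]bin_sub; [congr ('C(_, _)); lia|lia].
rewrite doubleS expnS; rewrite /= e3 in e1 e2.
have e4 : 'C(r.*2.+2, r.+1) = 2 * 'C(r.*2.+1, r.+1).
  by apply/eqP; rewrite -(eqn_pmul2l (ltn0Sn r)) -e2; apply/eqP; lia.
apply: (@leq_trans (4 * (r.*2.+1 * 'C(r.*2, r)))); first by rewrite leq_mul2l IH orbT.
rewrite e1 e4; lia.
Qed.

(** By Pascal's rule, applied once for odd [m] and twice for even [m], the coefficient just above
    the middle dominates ['C(r.*2, r)]. *)
Lemma bin_above_half_ge m (r := m.-1./2) : 0 < m ->
  4 ^ r <= r.*2.+1 * 'C(m, m./2.+1).
Proof.
move=> m0; apply: leq_trans (central_bin_ge r) _; rewrite leq_mul2l; apply/orP; right.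
have [hm|hm] : m = r.*2.+1 \/ m = r.*2.+2 by rewrite /r; lia.
  by rewrite (_ : m./2 = r) hm ?binS ?leq_addl //; lia.
by rewrite (_ : m./2 = r.+1) hm; [rewrite binS [X in _ + X]binS; lia | lia].
Qed.

Lemma INR_muln a b : INR (a * b) = Rmult (INR a) (INR b).
Proof. exact: mult_INR. Qed.

Lemma INR_addn a b : INR (a + b) = Rplus (INR a) (INR b).
Proof. exact: plus_INR. Qed.

Lemma INR_expn a m : INR (a ^ m) = pow (INR a) m.
Proof. by elim: m => // m IH; rewrite expnS INR_muln IH. Qed.

Lemma INR_leq a b : a <= b -> Rle (INR a) (INR b).
Proof. by move=> h; apply: le_INR; lia. Qed.

Lemma INR_subn a b : b <= a -> INR (a - b) = Rminus (INR a) (INR b).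
Proof. by move=> h; rewrite -minus_INR //; lia. Qed.

Local Open Scope R_scope.

(** * Real bounds on the failure probability *)

Lemma INR_divn_le a b : (0 < b)%N -> INR (a %/ b) <= INR a / INR b.
Proof.
move=> b0; have hb : 0 < INR b by apply: lt_0_INR; lia.
apply: (Rmult_le_reg_r (INR b)) => //; rewrite -INR_muln.
have -> : INR a / INR b * INR b = INR a by field; lra.
by apply: INR_leq; exact: leq_divM.
Qed.

Lemma one_minus_p1 n m l : (0 < n)%N -> 1 - p1 n m l = INR (failures n m l) / INR n ^ m.
Proof.
move=> n0; have hn : 0 < INR n by apply: lt_0_INR; lia.
have hnm := pow_lt _ m hn; rewrite /p1 INR_expn.
have e : (#|[pred s | one_wins n m l s]| + failures n m l = n ^ m)%N.
  have := cardC [pred s | one_wins n m l s]; rewrite card_ffun !card_ord => <-.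
  by congr addn; apply: eq_card => s; rewrite !inE.
rewrite -INR_expn in hnm *; apply: (Rmult_eq_reg_r (INR (n ^ m))); last lra.
have -> : INR (failures n m l) / INR (n ^ m) * INR (n ^ m) = INR (failures n m l) by field; lra.
transitivity (INR (n ^ m) - INR #|[pred s | one_wins n m l s]|); first by field; lra.
by rewrite -e INR_addn; lra.
Qed.

Lemma one_minus_p1_ge0 n m l : (0 < n)%N -> 0 <= 1 - p1 n m l.
Proof.
move=> n0; rewrite one_minus_p1 //; apply: Rmult_le_pos; first exact: pos_INR.
by apply: Rlt_le; apply: Rinv_0_lt_compat; apply: pow_lt; apply: lt_0_INR; lia.
Qed.

Lemma one_minus_p1_ge_novote n m l :
  ~~ odd n -> (2 <= l)%N -> (l.*2 < n)%N ->
  (1 - (INR l + 1) / INR n) ^ m <= 1 - p1 n m l.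
Proof.
move=> en l2 lhalf; have n0 : (0 < n)%N by lia.
have hn : 0 < INR n by apply: lt_0_INR; lia.
have -> : 1 - (INR l + 1) / INR n = INR (n - l.+1) / INR n.
  by rewrite INR_subn ?S_INR; [field; lra | lia].
rewrite one_minus_p1 // /Rdiv Rpow_mult_distr pow_inv -INR_expn.
apply: Rmult_le_compat_r; last by apply: INR_leq; apply: failures_ge_novote.
by apply: Rlt_le; apply: Rinv_0_lt_compat; apply: pow_lt.
Qed.

Lemma one_minus_p1_ge_majority n m l (x := INR l / INR n) (r := m.-1./2) :
  ~~ odd n -> (2 <= l)%N -> (l.*2 < n)%N -> (0 < m)%N -> 1 / 5 <= x ->
  1 / 25 * (4 * x * (1 - x)) ^ r <= INR m * (1 - p1 n m l).
Proof.
move=> en l2 lhalf m0 x5; have n0 : (0 < n)%N by lia.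
have hn : 0 < INR n by apply: lt_0_INR; lia.
have hnm := pow_lt _ m hn.
(* The majority has [d + r] voters and the minority [r], with [d] equal to 1 or 2. Pairing them
   gives the power of [4 * x * (1 - x)]; the leftover [x ^ d] is at least [1/25]. *)
pose d := (m./2.+1 - r)%N.
have mE : m = (d + r + r)%N by rewrite /d /r; lia.
have x1 : x < 1.
  apply: (Rmult_lt_reg_r (INR n)) => //; rewrite /x (_ : _ / _ * _ = INR l); last by field; lra.
  by rewrite Rmult_1_l; apply: lt_INR; lia.
have xd : 1 / 25 <= x ^ d.
  have [->|->] : d = 1%N \/ d = 2%N by rewrite /d /r; lia.
    by rewrite pow_1; lra.
  by rewrite /=; nra.
apply: (Rle_trans _ (x ^ d * (4 * x * (1 - x)) ^ r)).
  by apply: Rmult_le_compat_r => //; apply: pow_le; nra.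
rewrite one_minus_p1 //; apply: (Rmult_le_reg_r (INR n ^ m)) => //.
have -> : INR m * (INR (failures n m l) / INR n ^ m) * INR n ^ m = INR (m * failures n m l).
  by rewrite INR_muln; field; lra.
have -> : x ^ d * (4 * x * (1 - x)) ^ r * INR n ^ m = INR (4 ^ r * (l ^ (d + r) * (n - l) ^ r)).
  rewrite [in INR n ^ m]mE !pow_add !INR_muln !INR_expn INR_subn; last lia.
  rewrite pow_add (_ : INR 4 = 4); last by rewrite /=; lra.
  have -> : x ^ d * (4 * x * (1 - x)) ^ r * (INR n ^ d * INR n ^ r * INR n ^ r)
    = (x * INR n) ^ d * ((4 * x * (1 - x)) * INR n * INR n) ^ r.
    by rewrite !Rpow_mult_distr; ring.
  have -> : x * INR n = INR l by rewrite /x; field; lra.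
  have -> : 4 * x * (1 - x) * INR n * INR n = 4 * INR l * (INR n - INR l) by rewrite /x; field; lra.
  by rewrite !Rpow_mult_distr; ring.
apply: INR_leq; have := failures_ge_majority n m l en l2 lhalf.
have -> : (m./2.+1 = d + r)%N by rewrite /d /r; lia.
have -> : (m - (d + r) = r)%N by lia.
move=> h; apply: leq_trans (leq_mul (_ : r.*2.+1 <= m)%N h); last by rewrite /r; lia.
rewrite [X in (_ <= X)%N]mulnA leq_mul2r; apply/orP; right.
by have := bin_above_half_ge m m0; rewrite -/r (_ : m./2.+1 = d + r)%N // /d /r; lia.
Qed.

(** At [l = n %/ 5] both exponential bases approach [4/5]. First [K] is taken above [1 / eta], so
    that [n / (5K)] is small against [eta * n]; then [n] is taken large enough to absorb the term of
    order [K]. *)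
Lemma one_minus_p1_le_fifth (eta : R) : 0 < eta ->
  exists N : nat, forall n m : nat, (N <= n)%N -> ~~ odd n ->
    1 - p1 n m (n %/ 5) <= 3 * INR n * (4 / 5 + eta) ^ m.
Proof.
move=> eta0.
have [K hK] := INR_unbounded (1 / eta).
have K0 : (0 < K)%N.
  by case: K hK => // hK; have := Rdiv_lt_0_compat 1 eta ltac:(lra) eta0; move: hK; rewrite /=; lra.
have hKR : 0 < INR K by apply: lt_0_INR; lia.
have [N0 hN0] := INR_unbounded (4 * INR K / eta).
exists (maxn N0 10) => n m nN en; set l := (n %/ 5)%N; set y := 4 / 5 + eta.
have [l2 lhalf] : (2 <= l)%N /\ (l.*2 < n)%N by rewrite /l; lia.
have hn : 0 < INR n by apply: lt_0_INR; lia.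
have hnN : INR N0 <= INR n by apply: INR_leq; lia.
have n1 : 1 <= INR n by apply: (INR_leq 1); lia.
have Keta : 1 <= INR K * eta.
  have := Rmult_lt_compat_r eta _ _ eta0 hK; rewrite (_ : 1 / eta * eta = 1); first lra.
  by field; lra.
have neta : 4 * INR K <= INR n * eta.
  have := Rmult_lt_compat_r eta _ _ eta0 (Rlt_le_trans _ _ _ hN0 hnN).
  by rewrite (_ : 4 * INR K / eta * eta = 4 * INR K); [lra | field; lra].
rewrite one_minus_p1; last lia.
have hnm := pow_lt _ m hn.
apply: (Rmult_le_reg_r (INR n ^ m)) => //.
have -> : INR (failures n m l) / INR n ^ m * INR n ^ m = INR (failures n m l) by field; lra.
have yn0 : 0 <= (y * INR n) ^ m by apply: pow_le; rewrite /y; nra.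
have -> : 3 * INR n * y ^ m * INR n ^ m = 3 * INR n * (y * INR n) ^ m by rewrite Rpow_mult_distr; ring.
apply: (Rle_trans _ _ _ (INR_leq _ _ (failures_le n m l en l2 lhalf K K0))).
set W := (_ + _ - _)%N.
(* The bound [n <= 5 * l.+1] holds by the floor in [l]; [h'] covers the case where the subtraction
   in [W] truncates to 0. *)
have WE : (5 * W + K.-1 * n <= 5 * (K * n) + 10 * (K * K.-1))%N.
  have h : (K.-1 * n <= K.-1 * (5 * l.+1))%N by rewrite leq_mul2l; apply/orP; right; rewrite /l; lia.
  have h' : (K.-1 * n <= K * n)%N by rewrite leq_mul2r; lia.
  move: h h'; rewrite /W mulnCA; move: (K.-1 * n)%N (K * n)%N (K * K.-1)%N (K.-1 * l.+1)%N; lia.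
have expn_pos a : (0 < a)%N -> (0 < a ^ m)%N by move=> a0; rewrite expn_gt0 a0.
have first_round : INR (W ^ m %/ K ^ m) <= (y * INR n) ^ m.
  apply: (Rle_trans _ _ _ (INR_divn_le _ _ (expn_pos _ K0))).
  rewrite !INR_expn /Rdiv -pow_inv -Rpow_mult_distr -/(Rdiv _ _); apply: pow_incr; split.
    by apply: Rmult_le_pos; [exact: pos_INR | apply: Rlt_le; apply: Rinv_0_lt_compat].
  apply: (Rmult_le_reg_r (INR K)) => //.
  have -> : INR W / INR K * INR K = INR W by field; lra.
  move: (INR_leq _ _ WE); rewrite !INR_addn !INR_muln -subn1 INR_subn // /y.
  rewrite [INR 0](_ : _ = 0) // [INR 1](_ : _ = 1) // => h.
  have : INR n <= INR n * (INR K * eta) by nra.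
  have : 4 * INR K * INR K <= INR n * eta * INR K by nra.
  nra.
have final_round : INR ((n + 3 * l) ^ m %/ 2 ^ m) <= (y * INR n) ^ m.
  apply: (Rle_trans _ _ _ (INR_divn_le _ _ (expn_pos 2%N isT))).
  rewrite !INR_expn /Rdiv -pow_inv -Rpow_mult_distr -/(Rdiv _ _); apply: pow_incr.
  have h : 5 * INR l <= INR n.
    rewrite (_ : 5 = INR 5); last by rewrite /=; lra.
    by rewrite -INR_muln; apply: INR_leq; rewrite /l; lia.
  have := pos_INR l; rewrite INR_addn INR_muln.
  rewrite [INR 3](_ : _ = 3); last by rewrite /=; lra.
  by rewrite [INR 2](_ : _ = 2) // /y; split; nra.
rewrite INR_addn !INR_muln [INR 2](_ : _ = 2) //.
nra.
Qed.

(** * Absorbing polynomial factors, and the two limits *)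

Lemma exp_le_compat x y : x <= y -> exp x <= exp y.
Proof. by case=> [/exp_increasing/Rlt_le //|->]; apply: Rle_refl. Qed.

Lemma ln_le_compat x y : 0 < x -> x <= y -> ln x <= ln y.
Proof. by move=> x0; case=> [/(ln_increasing _ _ x0)/Rlt_le //|->]; apply: Rle_refl. Qed.

(** With [2 * a <= ln c], the power [c ^ M n] splits into two factors [exp (a * M n)]. One exceeds
    [n ^ 2], whose spare [n] absorbs [D / a]; the other exceeds [a * (M n + 1)] since [a <= 1]. *)
Lemma expn_dominates (M : nat -> nat)
  (hM : forall K : R, exists N : nat, forall n : nat, (N <= n)%N -> K <= INR (M n) / ln (INR n))
  (c D : R) : 1 < c -> 0 < D ->
  exists N : nat, forall n : nat, (N <= n)%N ->
    (0 < M n)%N /\ D * INR n * (INR (M n) + 1) < c ^ M n.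
Proof.
move=> c1 D0; set a := Rmin 1 (ln c / 2).
have lnc : 0 < ln c by rewrite -ln_1; apply: ln_increasing; lra.
have a0 : 0 < a by apply: Rmin_pos; lra.
have ac : 2 * a <= ln c by have := Rmin_r 1 (ln c / 2); rewrite -/a; lra.
have a1 : a <= 1 by exact: Rmin_l.
have [N1 hN1] := hM (2 / a).
have [N2 hN2] := INR_unbounded (D / a).
exists (maxn N1 (maxn N2 2)) => n nN.
have n2 : 2 <= INR n by apply: (INR_leq 2); lia.
have nN2 : INR N2 <= INR n by apply: INR_leq; lia.
have lnn : 0 < ln (INR n) by rewrite -ln_1; apply: ln_increasing; lra.
have aM : 2 * ln (INR n) <= a * INR (M n).
  have := hN1 n ltac:(lia) => h.
  have := Rmult_le_compat_r (a * ln (INR n)) _ _ ltac:(nra) h.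
  have -> : 2 / a * (a * ln (INR n)) = 2 * ln (INR n) by field; lra.
  by have -> : INR (M n) / ln (INR n) * (a * ln (INR n)) = a * INR (M n) by field; lra.
have M0 : 0 < INR (M n) by have := pos_INR (M n); nra.
split; first by have := INR_lt 0 _ M0; lia.
have aDn : D < a * INR n.
  have := Rmult_lt_compat_r a _ _ a0 (Rlt_le_trans _ _ _ hN2 nN2).
  by have -> : D / a * a = D by [field; lra]; lra.
have e1 : INR n * INR n <= exp (a * INR (M n)).
  rewrite -{1 2}(exp_ln (INR n)); last lra.
  rewrite -exp_plus; apply: exp_le_compat; lra.
have e2 : a * (INR (M n) + 1) <= exp (a * INR (M n)).
  by have := exp_ineq1_le (a * INR (M n)); nra.
have e3 : exp (a * INR (M n)) * exp (a * INR (M n)) <= c ^ M n.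
  rewrite -exp_plus -(exp_ln (c ^ M n)); last by apply: pow_lt; lra.
  by rewrite ln_pow; [apply: exp_le_compat; nra | lra].
apply: Rlt_le_trans e3.
apply: (Rlt_le_trans _ (INR n * INR n * (a * (INR (M n) + 1)))); last first.
  by apply: Rmult_le_compat => //; nra.
have : 0 < INR n * (INR (M n) + 1) by nra.
nra.
Qed.

Theorem mainTheorem8 (M : nat -> nat) (l : nat -> nat)
  (hM : forall K : R, exists N : nat, forall n : nat,
          (N <= n)%N -> K <= INR (M n) / ln (INR n))
  (hl : exists N : nat, forall n : nat,
          (N <= n)%N -> ~~ odd n -> (6 <= n)%N -> in_Lopt n (M n) (l n)) :
  (forall eps : R, 0 < eps -> exists N : nat, forall n : nat,
      (N <= n)%N -> ~~ odd n -> (6 <= n)%N ->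
      Rabs (INR (l n) / INR n - 1 / 5) < eps) /\
  (forall eps : R, 0 < eps -> exists N : nat, forall n : nat,
      (N <= n)%N -> ~~ odd n -> (6 <= n)%N ->
      1 - p1 n (M n) (l n) = 0 \/
      ln (1 - p1 n (M n) (l n)) / INR (M n) <= ln (4 / 5) + eps).
Proof.
case: hl => Nl hl.
(* Optimality transfers the bound at [n %/ 5] to [l n]. *)
have opt eta : 0 < eta -> exists N : nat, forall n : nat, (N <= n)%N -> ~~ odd n ->
    [/\ (10 <= n)%N, (2 <= l n)%N, ((l n).*2 < n)%N &
    1 - p1 n (M n) (l n) <= 3 * INR n * (4 / 5 + eta) ^ M n].
  move=> /one_minus_p1_le_fifth[N0 h0]; exists (maxn N0 (maxn Nl 10)) => n nN en.
  have [|//||lr lopt] := hl n; [lia | lia |].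
  split; [lia | lia | lia |].
  have := lopt (n %/ 5)%N ltac:(lia); have := h0 n (M n) ltac:(lia) en; lra.
split=> eps eps0.
  have [N1 h1] := opt (eps / 8) ltac:(lra).
  (* The constant 75 is 25 times 3: the [1 / 25] of the majority lower bound against the factor
     [3 * INR n] of the upper bound. *)
  have [N2 h2] := expn_dominates M hM (1 + eps / 10) 75 ltac:(lra) ltac:(lra).
  have [N3 h3] := INR_unbounded (2 / eps).
  exists (maxn N1 (maxn N2 N3)) => n nN en _.
  have [n10 l2 lhalf le] := h1 n ltac:(lia) en.
  have [M0] := h2 n ltac:(lia).
  have nN3 : INR N3 <= INR n by apply: INR_leq; lia.
  have hn : 10 <= INR n.
    by rewrite (_ : 10 = INR 10); [apply: INR_leq | rewrite /=; lra].
  have neps : 1 / INR n <= eps / 2.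
    apply: (Rmult_le_reg_r (INR n)); first lra.
    have -> : 1 / INR n * INR n = 1 by field; lra.
    have := Rmult_lt_compat_r eps _ _ eps0 (Rlt_le_trans _ _ _ h3 nN3).
    by have -> : 2 / eps * eps = 2 by [field; lra]; nra.
  set m := M n in M0 le *; set x := INR (l n) / INR n.
  set y := 4 / 5 + eps / 8 in le; set c := 1 + eps / 10 => grow.
  have x0 : 0 <= x by apply: Rmult_le_pos; [exact: pos_INR | apply: Rlt_le; apply: Rinv_0_lt_compat; lra].
  have x2 : x <= 1 / 2.
    apply: (Rmult_le_reg_r (INR n)); first lra.
    have -> : x * INR n = INR (l n) by rewrite /x; field; lra.
    have : INR (2 * l n) <= INR n by apply: INR_leq; lia.
    by rewrite INR_muln [INR 2](_ : _ = 2) //; lra.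
  have ym : 0 < y ^ m by apply: pow_lt; rewrite /y; lra.
  have mR := pos_INR m.
  (* A lower bound with base [c * y], even up to a factor [m + 1], contradicts the upper bound with
     base [y]. *)
  have contra (z : R) : 0 <= z -> z <= INR m + 1 -> 1 / 25 * (c * y) ^ m <= z * (1 - p1 n m (l n)) -> False.
    move=> z0 zm h.
    have : 1 / 25 * c ^ m * y ^ m <= (INR m + 1) * (3 * INR n) * y ^ m.
      apply: (Rle_trans _ (1 / 25 * (c * y) ^ m)); first by rewrite Rpow_mult_distr; lra.
      apply: (Rle_trans _ _ _ h); rewrite Rmult_assoc.
      by apply: Rmult_le_compat => //; apply: one_minus_p1_ge0; lia.
    move=> /(Rmult_le_reg_r _ _ _ ym); lra.
  apply: Rnot_le_lt => far.
  have [small|large] : x <= 1 / 5 - eps \/ 1 / 5 + eps <= x.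
    by move: far; rewrite /Rabs; case: Rcase_abs => _; lra.
  (* Here [1 - x - 1/n >= 4/5 + eps/2], which exceeds [c * y]. *)
  - apply: (contra 1); [lra | lra |].
    have := one_minus_p1_ge_novote n m (l n) en l2 lhalf.
    have -> : (INR (l n) + 1) / INR n = x + 1 / INR n by rewrite /x; field; lra.
    have : (c * y) ^ m <= (1 - (x + 1 / INR n)) ^ m by apply: pow_incr; rewrite /c /y; nra.
    have : 0 < (c * y) ^ m by apply: pow_lt; rewrite /c /y; nra.
    lra.
  apply: (contra (INR m)); [lra | lra |].
  apply: Rle_trans (one_minus_p1_ge_majority n m (l n) en l2 lhalf M0 _); last by rewrite -/x; lra.
  rewrite -/x; set r := m.-1./2.
  apply: Rmult_le_compat_l; first lra.
  have cy0 : 0 <= c * y by rewrite /c /y; nra.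
  have cy1 : c * y <= 1 by rewrite /c /y; nra.
  (* Since [1/5 + eps <= x <= 1/2], [eps] is at most [3/10], which makes the quadratic terms in
     [eps] harmless. *)
  have cy2 : (c * y) ^ 2 <= 4 * x * (1 - x).
    have : c * y <= 4 / 5 + eps * (21 / 100) by rewrite /c /y; nra.
    have : 16 / 25 + eps <= 4 * x * (1 - x) by nra.
    rewrite /=; nra.
  apply: (Rle_trans _ ((c * y) ^ (2 * r))).
    have -> : m = (2 * r + (m - 2 * r))%N by rewrite /r; lia.
    rewrite pow_add -[X in _ <= X]Rmult_1_r; apply: Rmult_le_compat_l; first exact: pow_le.
    by rewrite -(pow1 (m - 2 * r)); apply: pow_incr.
  by rewrite pow_mult; apply: pow_incr; split => //; exact: pow_le.
(* The slack [exp eps] is split in two: one [b] raises the base [4/5] to [4/5 * b], the other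
   absorbs the factor [3 * INR n]. *)
set b := exp (eps / 2).
have b1 : 1 < b by rewrite -exp_0; apply: exp_increasing; lra.
have [N1 h1] := opt (4 / 5 * (b - 1)) ltac:(lra).
have [N2 h2] := expn_dominates M hM b 3 b1 ltac:(lra).
exists (maxn N1 N2) => n nN en _.
have [n10 l2 lhalf le] := h1 n ltac:(lia) en.
have [M0 grow] := h2 n ltac:(lia).
have := one_minus_p1_ge0 n (M n) (l n) ltac:(lia).
(* Failure probability 0 takes the left disjunct, which renders the convention [log 0 = -oo]. *)
case=> [F0|]; [right | by left].
have m0 : 0 < INR (M n) by apply: lt_0_INR; lia.
have hn : 0 < INR n by apply: lt_0_INR; lia.
have lnE : ln (4 / 5) + eps = ln (b * (4 / 5 * b)).
  rewrite !ln_mult; try lra.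
  by rewrite /b ln_exp; lra.
apply: (Rmult_le_reg_r (INR (M n))) => //.
have -> : ln (1 - p1 n (M n) (l n)) / INR (M n) * INR (M n) = ln (1 - p1 n (M n) (l n)) by field; lra.
rewrite lnE Rmult_comm -ln_pow; last nra.
apply: ln_le_compat => //; apply: (Rle_trans _ _ _ le).
rewrite (_ : 4 / 5 + 4 / 5 * (b - 1) = 4 / 5 * b); last lra.
rewrite [X in _ <= X]Rpow_mult_distr; apply: Rmult_le_compat_r; first by apply: pow_le; lra.
nra.
Qed.
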